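(* Let $\Lambda\in R^*$ and let $\Lambda=\sum_{i=1}^d\mathbf 1_{\zeta_i}\circ p_i(\boldsymbol\delta)$ be a generalized decomposition of $\Lambda$. Then for every $i\in\{1,\dots,d\}$ and every $\alpha\in\mathbb N^n$ the element $$\mathbf 1_{\zeta_i}\circ(\partial^\alpha p_i)(\boldsymbol\delta)\in\mathcal A_\Lambda^*$$ is either the zero map or a generalized eigenvector common to every $M_{x_j}^t$ ($j=1,\dots,n$), with eigenvalue $(\zeta_i)_j$ (the $j$-th coordinate of $\zeta_i$). Moreover, the chain of $\mathbf 1_{\zeta_i}\circ(\partial^\alpha p_i)(\boldsymbol\delta)$ relative to $M_{x_j}^t$ is $$\{\mathbf 1_{\zeta_i}\circ(\partial^\alpha p_i)(\boldsymbol\delta),\ \mathbf 1_{\zeta_i}\circ(\partial_j\partial^\alpha p_i)(\boldsymbol\delta),\ \mathbf 1_{\zeta_i}\circ(\partial_j^2\partial^\alpha p_i)(\boldsymbol\delta),\dots\},$$ until a proper rank-$1$ eigenvector is reached.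
   Context: $\mathbb K$ is an algebraically closed field of characteristic $0$, $n\ge1$, $R=\mathbb K[x_1,\dots,x_n]$, $R^*=\mathrm{Hom}_{\mathbb K}(R,\mathbb K)$. For $\zeta\in\mathbb K^n$, $\mathbf 1_\zeta\in R^*$ is evaluation at $\zeta$. For $p\in R$, $p(\boldsymbol\delta):R\to R$ is the differential operator obtained from $p$ by replacing each variable $x_i$ with $\partial_i=\partial/\partial x_i$ (products becoming compositions). For $\alpha\in\mathbb N^n$, $\partial^\alpha p=\partial_1^{\alpha_1}\cdots\partial_n^{\alpha_n}p\in R$ is the derivative of the polynomial $p$, and $(\partial^\alpha p)(\boldsymbol\delta)$ the associated differential operator. For $a\in R$ and $\Lambda\in R^*$, $a\star\Lambda\in R^*$ is $b\mapsto\Lambda(ab)$; $I_\Lambda=\{a\in R:a\star\Lambda=0\}$ is an ideal and $\mathcal A_\Lambda=R/I_\Lambda$. The space $\mathcal A_\Lambda^*=\mathrm{Hom}_{\mathbb K}(\mathcal A_\Lambda,\mathbb K)$ is identified with $I_\Lambda^\perp=\{\Phi\in R^*:\Phi(h)=0\ \forall h\in I_\Lambda\}$. The operator $M_{x_j}^t:\mathcal A_\Lambda^*\to\mathcal A_\Lambda^*$ is $\varphi\mapsto x_j\star\varphi$. Consider expressions $\Lambda=\sum_{i=1}^d\mathbf 1_{\zeta_i}\circ p_i(\boldsymbol\delta)$ with $\zeta_i\in\mathbb K^n$ distinct and $p_i\in R$; such expressions exist exactly when $I_\Lambda$ is zero-dimensional (or $\Lambda=0$). The multiplicity of $\zeta_i$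 is $\dim_{\mathbb K}\langle\{\mathbf 1_{\zeta_i}\circ(\partial^\alpha p_i)(\boldsymbol\delta)\}_{\alpha\in\mathbb N^n}\rangle_{\mathbb K}$. The expression is called a generalized decomposition of $\Lambda$ if the sum of the multiplicities is minimal (in which case it equals $\dim_{\mathbb K}I_\Lambda^\perp$, the points are $\{\zeta_1,\dots,\zeta_d\}=\mathcal V(I_\Lambda)$, and all $p_i\ne0$). A vector $v$ is a generalized eigenvector of rank $m\ge1$ of an operator $M$, with eigenvalue $\mu$, if $(M-\mu)^mv=0$ and $(M-\mu)^{m-1}v\ne0$; its chain is $\{v,(M-\mu)v,\dots,(M-\mu)^{m-1}v\}$. *)

(* Defs.v *)
From HB Require Import structures.
From mathcomp Require Import all_boot all_order all_algebra.
From mathcomp Require Import mpoly.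
(* Classical reasoning makes R^* = Hom_K(R, K) an honest lmodType. *)
From mathcomp Require Import boolp functions.

Set Implicit Arguments.
Unset Strict Implicit.
Unset Printing Implicit Defensive.

Import GRing.Theory.
Local Open Scope ring_scope.

Definition linear_form (K : fieldType) (n : nat) : {pred {mpoly K[n]} -> K^o} :=
  fun f => `[< linear f >].

Lemma linear_form_submod (K : fieldType) (n : nat) :
  submod_closed (@linear_form K n).
Proof.
split; first by apply/asboolP => c u v; rewrite /= scaler0 addr0.
move=> c f g /asboolP lf /asboolP lg; apply/asboolP => k u v.
change (c *: f (k *: u + v) + g (k *: u + v)
  = k *: (c *: f u + g u) + (c *: f v + g v)).
by rewrite lf lg !scalerDr !scalerA mulrC addrACA.
Qed.

HB.instance Definition _ (K : fieldType) (n : nat) :=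
  GRing.isSubmodClosed.Build K ({mpoly K[n]} -> K^o) (@linear_form K n)
    (linear_form_submod K n).

(* R^* = Hom_K(R, K) for R = {mpoly K[n]} *)
Record dual (K : fieldType) (n : nat) := Dual {
  dual_val :> {mpoly K[n]} -> K^o;
  dual_valP : dual_val \in @linear_form K n
}.

HB.instance Definition _ (K : fieldType) (n : nat) :=
  [isSub for @dual_val K n].
HB.instance Definition _ (K : fieldType) (n : nat) :=
  [Choice of dual K n by <:].
HB.instance Definition _ (K : fieldType) (n : nat) :=
  [SubChoice_isSubZmodule of dual K n by <:].
HB.instance Definition _ (K : fieldType) (n : nat) :=
  [SubZmodule_isSubLmodule of dual K n by <:].

HB.instance Definition _ (K : fieldType) (n : nat) (L : dual K n) :=
  GRing.isLinear.Build K {mpoly K[n]} K^o *:%R (dual_val L)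
    (elimT (asboolP _) (dual_valP L)).

Lemma dual_linP (K : fieldType) (n : nat)
  (f : {linear {mpoly K[n]} -> K^o}) : (f : _ -> _) \in @linear_form K n.
Proof. by apply/asboolP => c u v; rewrite linearP. Qed.

Definition mkdual (K : fieldType) (n : nat)
  (f : {linear {mpoly K[n]} -> K^o}) : dual K n := Dual (dual_linP f).

Definition star (K : fieldType) (n : nat) (a : {mpoly K[n]}) (L : dual K n) :
  dual K n := mkdual (L \o (a \*o idfun)).

Definition annI (K : fieldType) (n : nat) (L : dual K n) : {pred {mpoly K[n]}} :=
  fun a => star a L == 0.

Definition perp (K : fieldType) (n : nat) (L : dual K n) : {pred dual K n} :=
  fun F => `[< forall h, h \in annI L -> F h = 0 >].

Lemma perp_submod (K : fieldType) (n : nat) (L : dual K n) :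
  submod_closed (perp L).
Proof.
split; first by apply/asboolP.
move=> c F G /asboolP hF /asboolP hG; apply/asboolP => h hI.
change (c *: F h + G h = 0).
by rewrite hF // hG // scaler0 addr0.
Qed.

HB.instance Definition _ (K : fieldType) (n : nat) (L : dual K n) :=
  GRing.isSubmodClosed.Build K (dual K n) (perp L) (perp_submod L).

(* A_L^* = Hom_K(R / I_L, K), identified with the forms vanishing on
   I_L = annI L; no quotient type is formed. *)
Record Adual (K : fieldType) (n : nat) (L : dual K n) := ADual {
  Adual_val :> dual K n;
  Adual_valP : Adual_val \in perp L
}.

Arguments Adual_val {K n L}.

HB.instance Definition _ (K : fieldType) (n : nat) (L : dual K n) :=
  [isSub for @Adual_val K n L].
HB.instance Definition _ (K : fieldType) (n : nat) (L : dual K n) :=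
  [Choice of Adual L by <:].
HB.instance Definition _ (K : fieldType) (n : nat) (L : dual K n) :=
  [SubChoice_isSubZmodule of Adual L by <:].
HB.instance Definition _ (K : fieldType) (n : nat) (L : dual K n) :=
  [SubZmodule_isSubLmodule of Adual L by <:].

Lemma annI_mull (K : fieldType) (n : nat) (L : dual K n) (a h : {mpoly K[n]}) :
  h \in annI L -> a * h \in annI L.
Proof.
move=> /eqP hI; apply/eqP/val_inj/funext => b.
have /= := congr1 (fun F : dual K n => F (a * b)) hI.
by rewrite mulrA [h * a]mulrC.
Qed.

Lemma star_perp (K : fieldType) (n : nat) (L : dual K n) (a : {mpoly K[n]})
  (F : Adual L) : star a F \in perp L.
Proof.
apply/asboolP => h hI /=.
by move/asboolP: (Adual_valP F); apply; apply: annI_mull.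
Qed.

(* The transpose M_{x_j}^t of multiplication by x_j on R / I_L *)
Definition mulXt (K : fieldType) (n : nat) (L : dual K n) (j : 'I_n)
  (F : Adual L) : Adual L := ADual (star_perp 'X_j F).

Arguments mulXt {K n} L j F.

(* p(delta): each x_i in p is replaced by d/dx_i, so x^m becomes ^`M[m]. *)
Definition diffop (K : fieldType) (n : nat) (p q : {mpoly K[n]}) :
  {mpoly K[n]} := \sum_(m <- msupp p) p@_m *: q^`M[m].

Lemma diffop_linear (K : fieldType) (n : nat) (p : {mpoly K[n]}) :
  linear (diffop p).
Proof.
move=> c u v; rewrite /diffop scaler_sumr -big_split /=.
apply: eq_bigr => m _.
by rewrite linearP scalerDr !scalerA mulrC.
Qed.

HB.instance Definition _ (K : fieldType) (n : nat) (p : {mpoly K[n]}) :=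
  GRing.isLinear.Build K {mpoly K[n]} {mpoly K[n]} *:%R (diffop p)
    (diffop_linear p).

Definition eval_at (K : fieldType) (n : nat) (z : 'rV[K]_n)
  (q : {mpoly K[n]}) : K^o := q.@[z 0].

Lemma eval_at_linear (K : fieldType) (n : nat) (z : 'rV[K]_n) :
  linear (eval_at z).
Proof. by move=> c u v; rewrite /eval_at mevalD mevalZ. Qed.

HB.instance Definition _ (K : fieldType) (n : nat) (z : 'rV[K]_n) :=
  GRing.isLinear.Build K {mpoly K[n]} K^o *:%R (eval_at z)
    (eval_at_linear z).

(* 1_z \o p(delta) *)
Definition point_diff (K : fieldType) (n : nat) (z : 'rV[K]_n)
  (p : {mpoly K[n]}) : dual K n := mkdual (eval_at z \o diffop p).

Definition in_span (K : fieldType) (V : lmodType K) (I : Type) (f : I -> V)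
  (v : V) : Prop :=
  exists (m : nat) (g : 'I_m -> I) (c : 'I_m -> K),
    v = \sum_(i < m) c i *: f (g i).

(* The subspace W, not necessarily inside a finite-dimensional space, has a
   basis of k vectors. *)
Definition has_dim (K : fieldType) (V : lmodType K) (W : V -> Prop) (k : nat) :
  Prop :=
  exists b : 'I_k -> V,
    [/\ forall i, W (b i),
        forall c : 'I_k -> K, \sum_(i < k) c i *: b i = 0 -> forall i, c i = 0
      & forall v, W v -> exists c : 'I_k -> K, v = \sum_(i < k) c i *: b i].

(* The multiplicity of the point z with weight p is a finite dimension (only
   finitely many derivatives of p are nonzero); it is given by its graph. *)
Definition is_multiplicity (K : fieldType) (n : nat) (z : 'rV[K]_n)
  (p : {mpoly K[n]}) (k : nat) : Prop :=
  has_dim (in_span (fun a : 'X_{1..n} => point_diff z p^`M[a])) k.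

Definition is_expression (K : fieldType) (n : nat) (L : dual K n) (d : nat)
  (zeta : 'I_d -> 'rV[K]_n) (p : 'I_d -> {mpoly K[n]}) : Prop :=
  injective zeta /\ L = \sum_(i < d) point_diff (zeta i) (p i).

Definition generalized_decomposition (K : fieldType) (n : nat) (L : dual K n)
  (d : nat) (zeta : 'I_d -> 'rV[K]_n) (p : 'I_d -> {mpoly K[n]}) : Prop :=
  is_expression L zeta p /\
  exists2 mu : 'I_d -> nat,
    forall i, is_multiplicity (zeta i) (p i) (mu i) &
    forall (d' : nat) (zeta' : 'I_d' -> 'rV[K]_n) (p' : 'I_d' -> {mpoly K[n]})
           (mu' : 'I_d' -> nat),
      is_expression L zeta' p' ->
      (forall i, is_multiplicity (zeta' i) (p' i) (mu' i)) ->
      (\sum_(i < d) mu i <= \sum_(i < d') mu' i)%N.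

Definition shift_op (K : fieldType) (V : lmodType K) (M : V -> V) (mu : K)
  (v : V) : V := M v - mu *: v.

Definition gen_eigenvector (K : fieldType) (V : lmodType K) (M : V -> V)
  (mu : K) (m : nat) (v : V) : Prop :=
  [/\ (0 < m)%N, iter m (shift_op M mu) v = 0
    & iter m.-1 (shift_op M mu) v <> 0].

Definition chain (K : fieldType) (V : lmodType K) (M : V -> V) (mu : K)
  (m : nat) (v : V) : seq V := traject (shift_op M mu) v m.

(* Main.v *)
(* By the Leibniz rule, (x_j - z_j) * (1_z o p(delta)) = 1_z o (d_j p)(delta), so
   shifted multiplication differentiates the weight and is nilpotent; this gives
   the chains.  For membership in the orthogonal of I_L, let h be in I_L, so that
   the sum of the h * (1_{z_k} o p_k(delta)) is h * L = 0.  A product of powers of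
   linear forms x_j - (z_k)_j over the points z_k <> z_i kills all the terms but
   the i-th, on which it is injective, so the i-th term vanishes too. *)
Require Import Defs.
From HB Require Import structures.
From mathcomp Require Import all_boot all_order all_algebra.
From mathcomp Require Import mpoly.
From mathcomp Require Import boolp functions.
From mathcomp Require Import ssrcomplements bigenough.

Set Implicit Arguments.
Unset Strict Implicit.
Unset Printing Implicit Defensive.

Import GRing.Theory BigEnough.
Local Open Scope ring_scope.

(** * The action of polynomials on linear forms *)

Lemma dual_eqP (K : fieldType) (n : nat) (F G : dual K n) :
  (forall q, F q = G q) -> F = G.
Proof. by move=> FG; apply/val_inj/funext. Qed.

Lemma star_is_linear (K : fieldType) (n : nat) (a : {mpoly K[n]}) :
  linear (@star K n a).
Proof. by move=> c F G; apply: dual_eqP. Qed.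

HB.instance Definition _ (K : fieldType) (n : nat) (a : {mpoly K[n]}) :=
  GRing.isLinear.Build K (dual K n) (dual K n) *:%R (@star K n a)
    (star_is_linear a).

Lemma starM (K : fieldType) (n : nat) (a b : {mpoly K[n]}) (F : dual K n) :
  star (a * b) F = star a (star b F).
Proof. by apply: dual_eqP => q /=; rewrite mulrCA mulrA. Qed.

Lemma starC (K : fieldType) (n : nat) (a b : {mpoly K[n]}) (F : dual K n) :
  star a (star b F) = star b (star a F).
Proof. by rewrite -!starM mulrC. Qed.

Lemma star1 (K : fieldType) (n : nat) (F : dual K n) : star 1 F = F.
Proof. by apply: dual_eqP => q /=; rewrite mul1r. Qed.

Lemma star_subC (K : fieldType) (n : nat) (a : {mpoly K[n]}) (c : K)
  (F : dual K n) : star (a - c%:MP) F = star a F - c *: F.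
Proof.
apply: dual_eqP => q /=.
by rewrite mulrBl mul_mpolyC linearB linearZ.
Qed.

(** * The Leibniz rule for differential operators *)

(** An index set independent of the support of [p] lets operators of different weights be added
    termwise. *)
Lemma diffopwE (K : fieldType) (n k : nat) (p q : {mpoly K[n]}) :
  (msize p <= k)%N ->
  diffop p q = \sum_(m : 'X_{1..n < k}) p@_m *: q^`M[m].
Proof.
move=> le_pk; rewrite /diffop (big_mksub 'X_{1..n < k}) /=; first last.
- by move=> m /msize_mdeg_lt/leq_trans/(_ le_pk).
- exact: msupp_uniq.
by rewrite big_rmcond //= => m /memN_msupp_eq0 ->; rewrite scale0r.
Qed.

Lemma diffopP_l (K : fieldType) (n : nat) (c : K) (p p' q : {mpoly K[n]}) :
  diffop (c *: p + p') q = c *: diffop p q + diffop p' q.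
Proof.
pose_big_enough k.
  rewrite !(@diffopwE _ _ k) // scaler_sumr -big_split /=.
  by apply: eq_bigr => m _; rewrite mcoeffD mcoeffZ scalerA scalerDl.
by close.
Qed.

Lemma diffop0_l (K : fieldType) (n : nat) (q : {mpoly K[n]}) : diffop 0 q = 0.
Proof. by rewrite /diffop msupp0 big_nil. Qed.

Lemma diffopX (K : fieldType) (n : nat) (m : 'X_{1..n}) (q : {mpoly K[n]}) :
  diffop 'X_[m] q = q^`M[m].
Proof. by rewrite /diffop msuppX big_seq1 mcoeffX eqxx scale1r. Qed.

(** At most one derivative can fall on ['X_j], and there are [m j] choices for it. When [m j = 0]
    the truncated [m - U_(j)] is harmless, its coefficient being zero. *)
Lemma mderivmXM (K : fieldType) (n : nat) (j : 'I_n) (m : 'X_{1..n})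
  (q : {mpoly K[n]}) :
  ('X_j * q)^`M[m] = 'X_j * q^`M[m] + (m j)%:R *: q^`M[m - U_(j)].
Proof.
have [N] := ubnP (mdeg m); elim: N m q => // N IH m q le_mN.
have [->|] := eqVneq m 0%MM.
  by rewrite mnm0E scale0r addr0 !mderivm0m.
(* Peel one derivative in a variable [k] occurring in [m], and use induction on the degree for the
   remaining [m']. *)
rewrite -mdeg_eq0 mdegE sum_nat_eq0 negb_forall => /existsP[k /= nz_mk].
have mE : m = (m - U_(k) + U_(k))%MM by rewrite submK // lep1mP.
set m' := (m - U_(k))%MM in mE.
have lt_m'N : (mdeg m' < N)%N.
  by move: le_mN; rewrite mE mdegD mdeg1 addn1.
rewrite mE mderivmDm mderivmU1m IH // mderivD mderivZ mderivM mderivX.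
rewrite mnm1E mnmDE mnm1E [in RHS]mderivmDm mderivmU1m -addrA addrCA; congr (_ + _).
(* If [k = j], the peeled derivative can hit ['X_j]; this extra copy raises the coefficient from
   [m' j] to [m' j + 1]. *)
have [<-|ne_kj] := eqVneq k j.
  have -> : (U_(k) - U_(k) = 0 :> 'X_{1..n})%MM.
    by apply/mnmP => l; rewrite mnmBE subnn mnm0E.
  rewrite addmK mpolyX0 scale1r mul1r addn1 -nat1r scalerDl scale1r.
  congr (_ + _); have [->|nz_m'k] := eqVneq (m' k) 0%N; first by rewrite !scale0r.
  by rewrite -mderivmU1m -mderivmDm submK // lep1mP.
rewrite scale0r mul0r add0r addn0 -mderivmU1m -mderivmDm.
have [->|nz_m'j] := eqVneq (m' j) 0%N; first by rewrite !scale0r.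
by rewrite addmC addmBA ?lep1mP // addmC.
Qed.

(** By linearity in [p] it suffices to treat monomials, where the Leibniz factor [m j] is the
    coefficient in the derivative of ['X_[m]]. *)
Lemma diffopXM (K : fieldType) (n : nat) (j : 'I_n) (p q : {mpoly K[n]}) :
  diffop p ('X_j * q) = 'X_j * diffop p q + diffop p^`M(j) q.
Proof.
elim/mpolyind: p => [|c m p _ _ IH].
  by rewrite mderiv0 !diffop0_l mulr0 addr0.
rewrite mderivD mderivZ mderivX scalerA !diffopP_l IH !diffopX mderivmXM.
by rewrite mulrDr -scalerAr scalerDr scalerA addrACA.
Qed.

Lemma mderivn_eq0 (K : fieldType) (n k : nat) (j : 'I_n) (p : {mpoly K[n]}) :
  (msize p <= k)%N -> p^`M(j, k) = 0.
Proof.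
move=> le_pk; apply/mpolyP => m; rewrite mcoeff_mderivm mcoeff0.
rewrite memN_msupp_eq0 ?mul0rn // msize_mdeg_ge //.
by rewrite mdegD mdegMn mdeg1 mul1n (leq_trans le_pk) ?leq_addr.
Qed.

Lemma point_diff0 (K : fieldType) (n : nat) (z : 'rV[K]_n) :
  point_diff z 0 = 0.
Proof. by apply: dual_eqP => q /=; rewrite diffop0_l linear0. Qed.

Lemma star_point_diff (K : fieldType) (n : nat) (z : 'rV[K]_n) (j : 'I_n)
  (p : {mpoly K[n]}) :
  star ('X_j - (z 0 j)%:MP) (point_diff z p) = point_diff z p^`M(j).
Proof.
rewrite star_subC; apply: dual_eqP => q /=.
change (eval_at z (diffop p ('X_j * q)) - z 0 j * eval_at z (diffop p q)
  = eval_at z (diffop p^`M(j) q)).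
by rewrite diffopXM /eval_at mevalD mevalM mevalXU addrAC subrr add0r.
Qed.

Lemma starX_point_diff (K : fieldType) (n : nat) (z : 'rV[K]_n) (j : 'I_n)
  (k : nat) (p : {mpoly K[n]}) :
  star (('X_j - (z 0 j)%:MP) ^+ k) (point_diff z p) = point_diff z p^`M(j, k).
Proof.
elim: k => [|k IH]; first by rewrite expr0 star1 mderivn0.
by rewrite exprS starM IH star_point_diff mderivnS.
Qed.

(** Reduces membership in [perp L] to the underived weight; [b] is a product of factors
    ['X_j - z_j], one per derivative in [a]. *)
Lemma point_diff_mderivm (K : fieldType) (n : nat) (z : 'rV[K]_n)
  (p : {mpoly K[n]}) (a : 'X_{1..n}) :
  exists b, point_diff z p^`M[a] = star b (point_diff z p).
Proof.
rewrite mderivm_foldr; elim: flatten => [|j s [b IH]] /=.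
  by exists 1; rewrite star1.
by exists (('X_j - (z 0 j)%:MP) * b); rewrite starM -IH star_point_diff.
Qed.

(** * Separation of the points *)

(** The joint generalized eigenspace at [z]; being stable under [star b], it spares finding a weight
    for [star b F]. *)
Definition locally_nilpotent (K : fieldType) (n : nat) (z : 'rV[K]_n)
  (F : dual K n) : Prop :=
  forall j : 'I_n, exists N, star (('X_j - (z 0 j)%:MP) ^+ N) F = 0.

Lemma locally_nilpotent_point_diff (K : fieldType) (n : nat) (z : 'rV[K]_n)
  (p : {mpoly K[n]}) : locally_nilpotent z (point_diff z p).
Proof.
move=> j; exists (msize p).
by rewrite starX_point_diff mderivn_eq0 ?point_diff0.
Qed.

Lemma locally_nilpotent_star (K : fieldType) (n : nat) (z : 'rV[K]_n)
  (b : {mpoly K[n]}) (F : dual K n) :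
  locally_nilpotent z F -> locally_nilpotent z (star b F).
Proof.
by move=> nilF j; have [N F0] := nilF j; exists N; rewrite starC F0 linear0.
Qed.

(* On [F], multiplication by [x_j - c] is a nonzero scalar plus a nilpotent. *)
Lemma star_shift_inj (K : fieldType) (n : nat) (z : 'rV[K]_n) (j : 'I_n)
  (c : K) (M : nat) (F : dual K n) :
  z 0 j != c -> locally_nilpotent z F ->
  star (('X_j - c%:MP) ^+ M) F = 0 -> F = 0.
Proof.
move=> ne_zc nilF; elim: M => [|M IH]; first by rewrite expr0 star1.
rewrite exprS starM; set G := star _ F => eigG; apply: IH.
(* [G] is killed by ['X_j - c], so the nilpotent ['X_j - z_j] acts on it as the nonzero scalar
   [c - z_j]. *)
have [N] := locally_nilpotent_star (('X_j - c%:MP) ^+ M) nilF j.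
rewrite -/G; have -> : star (('X_j - (z 0 j)%:MP) ^+ N) G
  = (c - z 0 j) ^+ N *: G.
  elim: N => [|N IHN]; first by rewrite !expr0 star1 scale1r.
  rewrite exprS starM IHN linearZ /= star_subC.
  move: eigG; rewrite star_subC => /subr0_eq ->.
  by rewrite -scalerBl scalerA -exprSr.
move/eqP; rewrite scaler_eq0 expf_eq0 subr_eq0 eq_sym (negPf ne_zc) andbF.
by move/eqP.
Qed.

Lemma point_separation (K : fieldType) (n : nat) (I : eqType)
  (zeta : I -> 'rV[K]_n) (p : I -> {mpoly K[n]}) (z : 'rV[K]_n) (s : seq I) :
  {in s, forall k, zeta k != z} ->
  exists g : {mpoly K[n]},
    {in s, forall k, star g (point_diff (zeta k) (p k)) = 0} /\
    forall F, locally_nilpotent z F -> star g F = 0 -> F = 0.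
Proof.
elim: s => [|k s IH] ne_s.
  by exists 1; split=> // F _; rewrite star1.
have [|g [g0 g_inj]] := IH.
  by move=> l ls; apply: ne_s; rewrite in_cons ls orbT.
have [j ne_j] : exists j, z 0 j != zeta k 0 j.
  apply/existsP; apply: contraT; rewrite negb_exists => /forallP eq_z.
  have /negP[] := ne_s k (mem_head _ _).
  by apply/eqP/rowP => j; have := eq_z j; rewrite negbK => /eqP.
have [N kill_k] := locally_nilpotent_point_diff (zeta k) (p k) j.
(* The coordinate [j] distinguishes [zeta k] from [z], and [N] is a nilpotency order for the term at
   [zeta k]. *)
exists (g * ('X_j - (zeta k 0 j)%:MP) ^+ N); split=> [l|F nilF].
  rewrite in_cons starM => /predU1P[->|ls]; first by rewrite kill_k linear0.
  by rewrite starC g0 // linear0.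
rewrite starM => /g_inj F0; apply: (star_shift_inj ne_j nilF).
exact: (F0 (locally_nilpotent_star _ nilF)).
Qed.

Lemma point_diff_perp (K : fieldType) (n : nat) (L : dual K n) (d : nat)
  (zeta : 'I_d -> 'rV[K]_n) (p : 'I_d -> {mpoly K[n]}) (i : 'I_d)
  (a : 'X_{1..n}) :
  is_expression L zeta p -> point_diff (zeta i) (p i)^`M[a] \in perp L.
Proof.
move=> [zeta_inj LE]; apply/asboolP => h /eqP hL.
have [|g [g0 g_inj]] := @point_separation _ _ _ zeta p (zeta i)
  [seq k <- enum 'I_d | k != i].
  by move=> k; rewrite mem_filter => /andP[ne_ki _]; rewrite (inj_eq zeta_inj).
have hi0 : star h (point_diff (zeta i) (p i)) = 0.
  apply: g_inj; first exact/locally_nilpotent_star/locally_nilpotent_point_diff.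
  have := congr1 (star g) hL; rewrite LE !linear_sum linear0 /=.
  rewrite (bigD1 i) //= big1 ?addr0 // => k ne_ki.
  by rewrite starC g0 ?linear0 // mem_filter ne_ki mem_enum.
have [b ->] := point_diff_mderivm (zeta i) (p i) a.
(* Both sides evaluate the form at the product of [b] and [h], so the vanishing for [h] settles all
   derivatives of the weight. *)
have -> : star b (point_diff (zeta i) (p i)) h
  = star h (point_diff (zeta i) (p i)) b by rewrite /= mulrC.
by rewrite hi0.
Qed.

(** * Chains and ranks *)

Lemma val_iter_shift_mulXt (K : fieldType) (n : nat) (L : dual K n) (j : 'I_n)
  (c : K) (k : nat) (v : Adual L) :
  Adual_val (iter k (shift_op (mulXt L j) c) v)
  = star (('X_j - c%:MP) ^+ k) v.
Proof.
elim: k => [|k IH]; first by rewrite expr0 star1.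
by rewrite exprS starM -IH star_subC.
Qed.

(** Entry [k] is the [k]-th iterate, killed by one more shift only if [m <= k.+1]; so the chain
    meets a proper eigenvector exactly at its end. *)
Lemma gen_eigenvector1 (K : fieldType) (V : lmodType K) (M : V -> V) (mu : K)
  (m k : nat) (v : V) :
  (forall l, iter l (shift_op M mu) v = 0 <-> (m <= l)%N) -> (k < m)%N ->
  gen_eigenvector M mu 1 (nth 0 (chain M mu m v) k) <-> k.+1 = m.
Proof.
(* [nth_traject] uses the starting point as default value; since [k < m], replacing [0] by [v]
   changes nothing. *)
move=> iter0 lt_km; rewrite /chain (set_nth_default v) ?size_traject // nth_traject //.
split=> [[_ /= /(iter0 k.+1) le_mk _]|mE].
  by apply/eqP; rewrite eqn_leq lt_km.
split=> //=; first by apply/(iter0 k.+1); rewrite mE.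
by move/iter0; rewrite -mE ltnn.
Qed.

Theorem theorem6p2 (K : closedFieldType) (charK : [pchar K] =i pred0)
  (n : nat) (n_gt0 : (0 < n)%N) (L : dual K n) (d : nat)
  (zeta : 'I_d -> 'rV[K]_n) (p : 'I_d -> {mpoly K[n]})
  (decL : generalized_decomposition L zeta p) (i : 'I_d) (a : 'X_{1..n}) :
  exists v : Adual L,
    Adual_val v = point_diff (zeta i) (p i)^`M[a] /\
    (v = 0 \/
     forall j : 'I_n, exists m : nat,
       [/\ gen_eigenvector (mulXt L j) (zeta i 0 j) m v,
           map Adual_val (chain (mulXt L j) (zeta i 0 j) m v)
           = [seq point_diff (zeta i) (p i)^`M[a]^`M(j, k) | k <- iota 0 m]
         & forall k : nat, (k < m)%N ->
             (gen_eigenvector (mulXt L j) (zeta i 0 j) 1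
                (nth 0 (chain (mulXt L j) (zeta i 0 j) m v) k)
              <-> k.+1 = m)]).
Proof.
have [exprL _] := decL; pose v := ADual (point_diff_perp i a exprL).
exists v; split=> //; have [->|/eqP nz_v] := pselect (v = 0); first by left.
right=> j; set T := shift_op (mulXt L j) (zeta i 0 j).
have valT k : Adual_val (iter k T v) = point_diff (zeta i) (p i)^`M[a]^`M(j, k).
  by rewrite val_iter_shift_mulXt starX_point_diff.
have nilT : exists m, iter m T v == 0.
  (* [msize] exceeds the degree of the weight, so that many derivatives in one variable kill it. *)
  exists (msize (p i)^`M[a]); apply/eqP/val_inj; rewrite /= valT.
  by rewrite mderivn_eq0 ?point_diff0.
(* The rank for [j] is the least exponent killing [v]; all later iterates then vanish too. *)
pose m := ex_minn nilT; exists m.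
have iter0 l : iter l T v = 0 <-> (m <= l)%N.
  rewrite /m; case: ex_minnP => m0 /eqP m00 min_m0.
  split=> [/eqP/min_m0 //|/subnK <-].
  rewrite iterD m00; apply/val_inj.
  by rewrite /= val_iter_shift_mulXt linear0.
have m_gt0 : (0 < m)%N.
  by rewrite lt0n; apply: contraNneq nz_v => m0; apply/eqP/(iter0 0%N); rewrite m0.
split; last by move=> k; apply: gen_eigenvector1.
- split=> //; first exact/iter0.
  by move/iter0; rewrite leqNgt prednK // leqnn.
- apply: (@eq_from_nth _ 0) => [|k]; rewrite size_map size_traject.
    by rewrite size_map size_iota.
  move=> lt_km; rewrite (nth_map v) ?size_traject // nth_traject // valT.
  by rewrite (nth_map 0%N) ?size_iota // nth_iota.
Qed.
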